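(* Let $(J,\mathcal{B})$ be a standard Borel space, let $\beta\in\mathcal{M}_+(\mathcal{B}^2)$, and let $\varphi\colon\mathcal{B}\to\mathbb{R}$ be a bounded continuous submodular set function with $\varphi(\emptyset)=\varphi(J)=0$. Let $$\mathcal{F}_\varphi(J,\mathcal{B},\beta)=\{\mu\in\mathcal{M}_+(\mathcal{B}^2):\ 0\le\mu\le\beta,\ \partial\mu\le\varphi\text{ on }\mathcal{B}\},\qquad \widetilde{\mathcal{F}}_\varphi(J,\mathcal{B},\beta)=\mathcal{F}_\varphi(J,\mathcal{B},\beta)/{\sim}.$$ Let $[\mu]\in\widetilde{\mathcal{F}}_\varphi(J,\mathcal{B},\beta)$, let $\psi:=\varphi-\partial\mu$ and $\psi^c(X):=\psi(X^c)$ for $X\in\mathcal{B}$, and let $$R:=(\beta-P(\mu)+P(\mu)^* )\wedge(\beta^*-P(\mu)^*+P(\mu)).$$ Then $[\mu]$ is an extreme point of $\widetilde{\mathcal{F}}_\varphi(J,\mathcal{B},\beta)$ if and only if the following two statements hold: (1) $\mathsf{bmm}(\kappa_{0,R})\cap\mathsf{bmm}(\psi)\cap\mathsf{bmm}(\psi^c)=\{0\}$; (2) there is no reduced circulation $\rho$ such that $0<\rho\le R$.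
   Context: $\mathcal{M}(\mathcal{B}^2)$ (resp. $\mathcal{M}_+(\mathcal{B}^2)$) is the set of finite signed (resp. nonnegative) measures on $(J\times J,\mathcal{B}^2)$, where $\mathcal{B}^2$ is the product Borel $\sigma$-algebra; $\mu\le\nu$ means $\nu-\mu$ is a nonnegative measure, and $0<\rho$ means $\rho$ is a nonzero nonnegative measure. $X^c=J\setminus X$. The boundary of $\mu$ is $\partial\mu(X)=\mu(X\times X^c)-\mu(X^c\times X)$, $X\in\mathcal{B}$. The meet is $(\mu\wedge\nu)(X)=\inf\{\mu(X_1)+\nu(X_2): X=X_1\sqcup X_2\}$ over measurable partitions. The transpose $\mu^*$ is defined by $\mu^*(E)=\mu(E^* )$, $E^*=\{(x,y):(y,x)\in E\}$. A circulation is $\gamma\in\mathcal{M}(\mathcal{B}^2)$ with $\gamma(X\times J)=\gamma(J\times X)$ for all $X\in\mathcal{B}$. A nonnegative measure $\gamma$ on $J\times J$ is reduced if $\gamma\wedge\gamma^*=0$. Reduction: for $\mu\in\mathcal{M}_+(\mathcal{B}^2)$, $P(\mu)=\mu-\mu\wedge\mu^*=(\mu-\mu^* )_+$ (positive part in the Hahn decomposition), and $\mu\sim\nu$ iff $P(\mu)=P(\nu)$, equivalently $\mu-\mu^*=\nu-\nu^*$; $[\mu]$ denotes the equivalence class. The quotient carries the convex structure $c[\mu_1]+(1-c)[\mu_2]:=[c\mu_1+(1-c)\mu_2]$ for $0\le c\le1$ (well defined; the quotient is affinely isomorphic to the image of $\mathcal{F}_\varphi(J,\mathcal{B},\beta)$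 under the linear map $\mu\mapsto\mu-\mu^*$). Since $\partial\mu=\partial P(\mu)$, $\partial\mu$ depends only on $[\mu]$. A point of a convex set is extreme if it is not the midpoint of two distinct points of the set. A set function $\varphi$ is submodular if $\varphi(A)+\varphi(B)\ge\varphi(A\cap B)+\varphi(A\cup B)$ for all $A,B\in\mathcal{B}$, and continuous if $\varphi(A_n)\to\varphi(A)$ whenever $A,A_n\in\mathcal{B}$ and $\mathbf{1}_{A_n}\to\mathbf{1}_A$ pointwise on $J$. For $\alpha'\le\beta'$ in $\mathcal{M}(\mathcal{B}^2)$, $\kappa_{\alpha',\beta'}(X)=\beta'(X\times X^c)-\alpha'(X^c\times X)$; so $\kappa_{0,R}(X)=R(X\times X^c)$. A charge is a finitely additive real-valued set function on $\mathcal{B}$; for submodular $\psi$ with $\psi(\emptyset)=0$, $\mathsf{bmm}(\psi)$ is the set of charges $\delta$ on $\mathcal{B}$ with $\delta\le\psi$ on $\mathcal{B}$ and $\delta(J)=\psi(J)$. *)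

(* Defs.v *)
From HB Require Import structures.
From mathcomp Require Import all_boot all_order all_algebra.
From mathcomp Require Import all_classical all_reals all_analysis.

Set Implicit Arguments.
Unset Strict Implicit.
Unset Printing Implicit Defensive.

Import Order.TTheory GRing.Theory Num.Theory.
Import numFieldNormedType.Exports.

Local Open Scope classical_set_scope.
Local Open Scope ring_scope.
Local Open Scope ereal_scope.

(* A (finite) signed measure is a library [charge].  Library measures and
   charges are total functions on [set T] whose values on nonmeasurable sets
   are meaningless, so every comparison below is restricted to measurable
   sets. *)

(* M_+(B^2) *)
Notation finite_measure2 J R :=
  {finite_measure set (J * J)%type -> \bar R}.

Section standard_borel.
Context (R : realType) (d : measure_display) (T : measurableType d).

(* T is Borel isomorphic to a complete separable metric space. *)
Definition standard_borel : Prop :=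
  exists (X : metricType R) (f : T -> X),
    [/\ forall F : set_system X, ProperFilter F -> cauchy F ->
          exists x : X, F --> x,
        exists D : set X, countable D /\ dense D,
        bijective f
      & @measurable d T = [set f @^-1` B | B in <<s @open X >>] ].

End standard_borel.

Section set_functions.
Context (R : realType) (d : measure_display) (T : measurableType d).
Implicit Types f g : set T -> \bar R.

Definition eq_meas f g := forall X, measurable X -> f X = g X.

Definition le_meas f g := forall X, measurable X -> f X <= g X.

Definition meet f g : set T -> \bar R := fun X =>
  ereal_inf [set y | exists X1 X2, [/\ measurable X1, measurable X2,
    X1 `|` X2 = X, X1 `&` X2 = set0 & y = f X1 + g X2]].

Definition bounded_set_function (phi : set T -> R) :=
  exists M : R, forall X, measurable X -> (`|phi X| <= M)%R.

Definition submodular (phi : set T -> R) := forall A B,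
  measurable A -> measurable B ->
  (phi (A `&` B) + phi (A `|` B) <= phi A + phi B)%R.

Definition continuous_set_function (phi : set T -> R) :=
  forall (A : set T) (A_ : (set T)^nat),
    measurable A -> (forall n, measurable (A_ n)) ->
    (forall x, (\1_(A_ n) x : R) @[n --> \oo] --> (\1_A x : R)) ->
    phi (A_ n) @[n --> \oo] --> phi A.

Definition bmm (psi : set T -> \bar R) : set (additive_charge T R) :=
  [set delta | le_meas delta psi /\ delta setT = psi setT].

Definition compl_fun (psi : set T -> \bar R) : set T -> \bar R :=
  fun X => psi (~` X).

End set_functions.

Section square.
Context (R : realType) (d : measure_display) (T : measurableType d).
Implicit Types mu nu : set (T * T) -> \bar R.

Definition boundary mu : set T -> \bar R :=
  fun X => mu (X `*` ~` X) - mu (~` X `*` X).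

Definition transpose mu : set (T * T) -> \bar R :=
  fun E => mu [set p | E (p.2, p.1)].

Definition circulation mu := forall X : set T, measurable X ->
  mu (X `*` setT) = mu (setT `*` X).

Definition reduced mu := eq_meas (meet mu (transpose mu)) (cst 0).

Definition kappa (alpha' beta' : set (T * T) -> \bar R) : set T -> \bar R :=
  fun X => beta' (X `*` ~` X) - alpha' (~` X `*` X).

Definition reduction mu : set (T * T) -> \bar R :=
  mu \- meet mu (transpose mu).

Definition red_equiv mu nu := eq_meas (reduction mu) (reduction nu).

End square.

Section flows.
Context (R : realType) (d : measure_display) (J : measurableType d).
Variables (phi : set J -> R) (beta : finite_measure2 J R).

(* The condition 0 <= mu is part of the type of mu. *)
Definition flow : set (finite_measure2 J R) :=
  [set mu | le_meas mu beta /\ le_meas (boundary mu) (EFin \o phi)].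

(* Points of the quotient are represented by equivalence classes. *)
Definition flow_class (mu : finite_measure2 J R) :
    set (finite_measure2 J R) :=
  [set nu | flow nu /\ red_equiv mu nu].

Definition flow_quotient : set (set (finite_measure2 J R)) :=
  [set flow_class mu | mu in flow].

(* c [mu1] + (1 - c) [mu2] *)
Definition class_conv (c : R)
    (C1 C2 : set (finite_measure2 J R)) :
    set (finite_measure2 J R) :=
  [set nu | flow nu /\ exists mu1 mu2, [/\ C1 mu1, C2 mu2 &
    red_equiv (fun E => c%:E * mu1 E + (1 - c)%:E * mu2 E) nu]].

Definition extreme_class (C : set (finite_measure2 J R)) :=
  flow_quotient C /\
  ~ exists C1 C2, [/\ flow_quotient C1, flow_quotient C2, C1 <> C2
                    & C = class_conv 2^-1 C1 C2].

Definition residual (mu : finite_measure2 J R) :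
    set (J * J) -> \bar R :=
  let P := reduction mu in
  meet (beta \- P \+ transpose P) (transpose beta \- transpose P \+ P).

End flows.

(* Main.v *)
Require Import Defs.
From HB Require Import structures.
From mathcomp Require Import all_boot all_order all_algebra.
From mathcomp Require Import all_classical all_reals all_analysis.
From mathcomp Require Import measurable_realfun lra.

(** Write [mu^*] for the transpose of [mu].  The class of [mu] is determined by
    the antisymmetric signed measure [a = mu - mu^*], and [boundary mu X] is
    [a (X `*` ~` X)].  A flow in the class of [a] exists iff [a <= beta] and
    [a (X `*` ~` X) <= phi X] for all [X]: the positive part of [a] is then a
    flow, and it is the least representative.  So the quotient is affinely a
    set of antisymmetric measures cut out by linear inequalities, and [a] is
    extreme in it iff no nonzero antisymmetric [eta] keeps both [a + eta] and
    [a - eta] inside ([extreme_classP]).  Transposing the condition on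
    [a - eta] turns the two capacity constraints into the single bound
    [eta <= Res], [Res] being the meet of [beta - a] and [beta^* + a]
    ([residualP]); the two boundary constraints say that
    [delta X = eta (X `*` ~` X)] satisfies [`|delta| <= psi].

    For such a perturbation [eta], the charge [delta] lies in the three base
    polytopes, since [- delta X = delta (~` X)].  If their intersection is
    trivial, then [delta = 0], and the positive part of [eta] is a reduced
    circulation below [Res] ([antisymmetric_jordan]); if there is no such
    circulation except [0], then [eta = 0].

    Conversely a reduced circulation [rho <= Res] gives the perturbation
    [rho - rho^*], whose [delta] vanishes, and a charge [delta] in the three
    base polytopes has to be realised by a perturbation.  The latter is a
    supply-demand theorem ([Hoffman]): if [delta setT = 0] and
    [delta X <= m (X `*` ~` X)] for all [X], some [nu] between [0] and [m] has
    boundary [delta], and [nu - nu^*] is the required [eta].  It is proved by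
    duality.  On [L^1(m)] the functional [f |-> \int f^+ dm] is sublinear, and
    the prescription [u(x) - u(y) |-> \int u d delta] is dominated by it; this
    domination is the coarea inequality [coarea], the integral form over the
    superlevel sets of [u] of the hypothesis on [delta].  A linear functional
    [L] between the two is supplied by [Mazur_Orlicz], and [nu E] is the value
    of [L] on the indicator of [E]; it is countably additive because it is
    squeezed between [0] and [m]. *)

Import Order.TTheory GRing.Theory Num.Theory.
Import numFieldNormedType.Exports.
Local Open Scope classical_set_scope.
Local Open Scope ring_scope.

Set Implicit Arguments.
Unset Strict Implicit.
Unset Printing Implicit Defensive.

(** * Real-valued signed measures *)

Section signed_measures.
Context (R : realType) (d : measure_display) (T : measurableType d).
Implicit Types (f g h m : set T -> R) (A B E H X : set T).

(** Charges are replaced by their real-valued counterparts so that linear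
    combinations can be handled by real arithmetic.  As for charges, the values
    on nonmeasurable sets carry no information. *)
Definition signed_measure f := f set0 = 0 /\
  forall F : (set T)^nat, (forall n, measurable (F n)) -> trivIset setT F ->
    (\sum_(0 <= i < n) f (F i)) @[n --> \oo] --> f (\bigcup_n F n).

Lemma signed_measureU f A B : signed_measure f ->
  measurable A -> measurable B -> A `&` B = set0 -> f (A `|` B) = f A + f B.
Proof.
move=> [f0 sf] mA mB AB.
have := sf (bigcup2 A B); rewrite bigcup2E => h.
have {}h : \sum_(0 <= i < n) f (bigcup2 A B i) @[n --> \oo] --> f (A `|` B).
  apply: h; first by move=> [|[|n]] /=.
  apply/trivIsetP => -[|[|i]] [|[|j]] _ _ //= _; rewrite ?set0I ?setI0 //.
  by rewrite setIC.
apply: (cvg_unique (@Rhausdorff R) h).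
apply: cvg_near_cst; exists 2%N => // -[|[|n]] //= _.
by rewrite big_nat_recl // big_nat_recl //= big1 ?addr0.
Qed.

Lemma signed_measureID f A B : signed_measure f ->
  measurable A -> measurable B -> f A = f (A `&` B) + f (A `&` ~` B).
Proof.
move=> sf mA mB; rewrite -signed_measureU //.
- by rewrite -setIUr setUv setIT.
- exact: measurableI.
- by apply: measurableI => //; exact: measurableC.
- by rewrite setIACA setICr setI0.
Qed.

Lemma signed_measureD f g : signed_measure f -> signed_measure g ->
  signed_measure (fun X => f X + g X).
Proof.
move=> [f0 sf] [g0 sg]; split=> [|F mF tF]; first by rewrite f0 g0 addr0.
under eq_fun do rewrite big_split.
exact: cvgD (sf _ mF tF) (sg _ mF tF).
Qed.

Lemma signed_measureZ (c : R) f : signed_measure f ->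
  signed_measure (fun X => c * f X).
Proof.
move=> [f0 sf]; split=> [|F mF tF]; first by rewrite f0 mulr0.
under eq_fun do rewrite -mulr_sumr.
exact: cvgMr (sf _ mF tF).
Qed.

Lemma signed_measureN f : signed_measure f -> signed_measure (fun X => - f X).
Proof.
move=> /(signed_measureZ (-1)); congr signed_measure.
by apply/funext => X; rewrite mulN1r.
Qed.

Lemma signed_measureB f g : signed_measure f -> signed_measure g ->
  signed_measure (fun X => f X - g X).
Proof. by move=> sf sg; exact: signed_measureD sf (signed_measureN sg). Qed.

Lemma signed_measure_cst0 : signed_measure (cst 0).
Proof.
split=> // F _ _; under eq_fun do rewrite big1 //.
exact: cvg_cst.
Qed.

Lemma signed_measure_restr f H : signed_measure f -> measurable H ->
  signed_measure (fun X => f (X `&` H)).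
Proof.
move=> [f0 sf] mH; split=> [|F mF tF]; first by rewrite set0I.
rewrite setI_bigcupl; apply: sf => [n|]; first exact: measurableI.
exact: trivIset_setIr.
Qed.

Lemma additive_chargeU (c : additive_charge T R) A B :
  measurable A -> measurable B -> A `&` B = set0 ->
  fine (c (A `|` B)) = fine (c A) + fine (c B).
Proof.
move=> mA mB AB.
have c0 : c set0 = 0%E.
  have := @charge_semi_additive _ _ _ c (fun=> set0) 0%N.
  by rewrite !big_ord0; apply=> //; exact: trivIset_set0.
have := @charge_semi_additive _ _ _ c (bigcup2 A B) 2%N.
rewrite !big_ord_recr !big_ord0 /= set0U add0e => -> //.
- by rewrite fineD //; exact: fin_num_measure.
- by move=> [|[|n]] /=.
- apply/trivIsetP => -[|[|i]] [|[|j]] _ _ //= _; rewrite ?set0I ?setI0 //.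
  by rewrite setIC.
- exact: measurableU.
Qed.

Lemma signed_measure_charge (c : charge T R) : signed_measure (fine \o c).
Proof.
split=> [|F mF tF] /=; first by rewrite charge0.
have mU : measurable (\bigcup_n F n) by exact: bigcup_measurable.
have := @charge_semi_sigma_additive _ _ _ c F mF tF mU.
rewrite -{1}(fineK (fin_num_measure c _ mU)) => /fine_cvgP[_].
apply: cvg_trans; apply: near_eq_cvg; apply: nearW => n /=.
rewrite -sum_fine => [|i _]; last exact: fin_num_measure.
by [].
Qed.

Lemma signed_measure_finite_measure (m : {finite_measure set T -> \bar R}) :
  signed_measure (fine \o m).
Proof. exact: (signed_measure_charge (charge_of_finite_measure m)). Qed.

Lemma EFin_semi_sigma_additive f : signed_measure f ->
  semi_sigma_additive (EFin \o f).
Proof.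
move=> [_ sf] F mF tF _; under eq_fun do rewrite sumEFin.
by apply: cvg_EFin; [exact: nearW|exact: sf].
Qed.

Lemma charge_of_signed_measure f : signed_measure f ->
  exists c : charge T R, forall X, c X = (f X)%:E.
Proof.
move=> sf; pose g := EFin \o f.
pose b := isCharge.Build _ T R g (congr1 EFin sf.1) (fun X _ => erefl)
  (EFin_semi_sigma_additive sf).
pose c : charge T R := HB.pack g b.
by exists c.
Qed.

(** A measure has to be nonnegative on all sets, measurable or not, so the
    witness is the pointwise absolute value. *)
Lemma finite_measure_of_signed_measure f : signed_measure f ->
  (forall X, measurable X -> 0 <= f X) ->
  exists m : {finite_measure set T -> \bar R},
    forall X, measurable X -> m X = (f X)%:E.
Proof.
move=> [f0 sf] f_ge0.
pose g X : \bar R := `|f X|%:E.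
have g0 : g set0 = 0%E by rewrite /g f0 normr0.
have g_ge0 X : (0 <= g X)%E by rewrite lee_fin.
have sg : semi_sigma_additive g.
  move=> F mF tF mU.
  have -> : g (\bigcup_n F n) = (f (\bigcup_n F n))%:E by rewrite /g ger0_norm ?f_ge0.
  rewrite (_ : (fun n => _) = EFin \o (fun n => \sum_(0 <= i < n) f (F i))).
    by apply: cvg_EFin; [exact: nearW|exact: sf].
  apply/funext => n /=; rewrite -sumEFin; apply: eq_bigr => i _.
  by rewrite /g ger0_norm ?f_ge0.
have fg : fin_num_fun g by [].
pose b := isMeasure.Build _ T R g g0 g_ge0 sg.
pose m : {measure set T -> \bar R} := HB.pack g b.
pose b' := @Measure_isFinite.Build _ T R m fg.
pose m' : {finite_measure set T -> \bar R} := HB.pack g b b'.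
by exists m' => X mX; rewrite /m' /= /g ger0_norm ?f_ge0.
Qed.

(** An additive function dominated by a measure inherits continuity along
    tails, hence countable additivity. *)
Lemma signed_measure_dominated f m :
  (forall A B, measurable A -> measurable B -> A `&` B = set0 ->
     f (A `|` B) = f A + f B) ->
  signed_measure m -> (forall X, measurable X -> `|f X| <= m X) ->
  signed_measure f.
Proof.
move=> fU [m0 sm] fm.
have f0 : f set0 = 0.
  have := fU set0 set0 measurable0 measurable0; rewrite setU0 setI0.
  by move=> /(_ erefl)/eqP; rewrite -subr_eq0 opprD addNKr oppr_eq0 => /eqP.
split=> // F mF tF.
(* For an additive [h], the distance from a partial sum to [h] of the union is
   the value of [h] on the tail. *)
have part h : (forall A B, measurable A -> measurable B -> A `&` B = set0 ->
     h (A `|` B) = h A + h B) -> h set0 = 0 -> forall n,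
   h (\bigcup_n F n) = \sum_(0 <= i < n) h (F i) + h (\bigcup_(i in ~` `I_n) F i).
  move=> hU h0; elim=> [|n IH].
    rewrite big_geq // add0r; congr h; apply: eq_bigcupl; split=> // x _.
  rewrite IH big_nat_recr //= -addrA; congr (_ + _).
  rewrite -hU //.
  - congr h; apply/seteqP; split=> x /=.
      move=> [i ni Fx]; have [ni'|ni'] := eqVneq i n; first by left; rewrite -ni'.
      by right; exists i => //=; rewrite ltnS leq_eqVlt (negbTE ni').
    move=> [Fx|[i ni Fx]]; first by exists n => //=; rewrite ltnn.
    by exists i => //= ni'; apply: ni; exact: leqW.
  - by apply: bigcup_measurable.
  - rewrite setI_bigcupr; apply: bigcup0 => i ni.
    move/trivIsetP : tF; apply => //; apply/eqP => ni'; apply: ni.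
    by rewrite /= -ni' ltnSn.
apply/cvgrPdist_le => e e0.
have := sm F mF tF => /cvgrPdist_le /(_ e e0); apply: filterS => n.
have mU A B : measurable A -> measurable B -> A `&` B = set0 ->
    m (A `|` B) = m A + m B by exact: (signed_measureU (conj m0 sm)).
rewrite (part m mU m0 n) (part f fU f0 n) !(addrC (\sum_(_ <= _ < _) _)) !addrK.
apply: le_trans; apply: le_trans (ler_norm _).
by apply: fm; exact: bigcup_measurable.
Qed.

Lemma Hahn f : signed_measure f -> exists H,
  [/\ measurable H, forall X, measurable X -> X `<=` H -> 0 <= f X &
    forall X, measurable X -> X `<=` ~` H -> f X <= 0].
Proof.
move=> /charge_of_signed_measure[c cE].
have [P [N [[mP P0] [mN N0] PN PN0]]] := Hahn_decomposition c.
exists P; split=> // X mX XP; rewrite -lee_fin -cE; first exact: P0.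
apply: N0 => // x /XP Px.
by have : (P `|` N) x; [rewrite PN|case].
Qed.

Lemma eq_meet (f f' g g' : set T -> \bar R) : eq_meas f f' -> eq_meas g g' ->
  meet f g = meet f' g'.
Proof.
move=> ff' gg'; apply/funext => X; congr ereal_inf; apply/seteqP; split=> y /=.
  by move=> [A [B [mA mB AB AB0 ->]]]; exists A, B; split=> //; rewrite ff' // gg'.
by move=> [A [B [mA mB AB AB0 ->]]]; exists A, B; split=> //; rewrite ff' // gg'.
Qed.

(** The infimum is attained: on a Hahn set of [g - f] the smaller summand is
    [f], off it [g].  Hence the meet is again a signed measure, and it is the
    greatest lower bound. *)
Lemma meetP f g : signed_measure f -> signed_measure g ->
  exists c, [/\ signed_measure c, eq_meas (meet (EFin \o f) (EFin \o g)) (EFin \o c),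
    forall X, measurable X -> c X <= f X, forall X, measurable X -> c X <= g X &
    forall h, signed_measure h -> (forall X, measurable X -> h X <= f X) ->
      (forall X, measurable X -> h X <= g X) ->
      forall X, measurable X -> h X <= c X].
Proof.
move=> sf sg; have [H [mH H0 H1]] := Hahn (signed_measureB sg sf).
have mI X : measurable X -> measurable (X `&` H) by move=> ?; exact: measurableI.
have mD X : measurable X -> measurable (X `&` ~` H).
  by move=> ?; apply: measurableI => //; exact: measurableC.
pose c X := f (X `&` H) + g (X `&` ~` H).
have cf X : measurable X -> c X <= f X.
  move=> mX; rewrite (signed_measureID sf mX mH) lerD2l -subr_le0.
  by apply: H1; [exact: mD|exact: subIsetr].
have cg X : measurable X -> c X <= g X.
  move=> mX; rewrite (signed_measureID sg mX mH) lerD2r -subr_ge0.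
  by apply: H0; [exact: mI|exact: subIsetr].
have sc : signed_measure c.
  apply: signed_measureD; first exact: signed_measure_restr.
  by apply: signed_measure_restr => //; exact: measurableC.
exists c; split=> //.
  move=> X mX; apply/eqP; rewrite eq_le; apply/andP; split.
    apply: ereal_inf_lbound; exists (X `&` H), (X `&` ~` H); split=> //.
    - exact: mI.
    - exact: mD.
    - by rewrite -setIUr setUv setIT.
    - by rewrite setIACA setICr setI0.
  apply: le_ereal_inf_tmp => _ [A [B [mA mB <- AB0 ->]]].
  by rewrite /= lee_fin (signed_measureU sc) // lerD // ?cf ?cg.
move=> h sh hf hg X mX; rewrite (signed_measureID sh mX mH).
by apply: lerD; [apply: hf; exact: mI|apply: hg; exact: mD].
Qed.

End signed_measures.

Lemma signed_measure_pushforward (R : realType) (d1 d2 : measure_display)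
    (T1 : measurableType d1) (T2 : measurableType d2) (g : T1 -> T2)
    (f : set T1 -> R) : measurable_fun setT g ->
  signed_measure f -> signed_measure (fun X => f (g @^-1` X)).
Proof.
move=> mg [f0 sf]; split=> [|F mF tF]; first by rewrite preimage_set0.
rewrite preimage_bigcup; apply: sf => [n|].
  by rewrite -[X in measurable X]setTI; exact: mg.
apply/trivIsetP => i j _ _ ij; rewrite -preimage_setI.
by move/trivIsetP : tF => /(_ _ _ _ _ ij) ->//; rewrite preimage_set0.
Qed.

(** * The Mazur-Orlicz theorem *)

Section mazur_orlicz.
Context (R : realType) (V : lmodType R).
Implicit Types (p q L : V -> R) (C : V -> R -> Prop) (f g v : V) (t c : R).

(** The inequality [p (t *: f) <= t * p f] for [t > 0] already gives equality,
    by applying it to [t^-1], and it forces [p 0 = 0]. *)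
Definition sublinear p := (forall f g, p (f + g) <= p f + p g) /\
  (forall t f, 0 < t -> p (t *: f) <= t * p f).

Definition convex_cone C := [/\ C 0 0,
  forall v w c e, C v c -> C w e -> C (v + w) (c + e) &
  forall t v c, 0 < t -> C v c -> C (t *: v) (t * c)].

(** The largest sublinear functional below [p] that is at most [- c] at [- v]
    for all [(v, c)] in the cone [C]. *)
Definition shifted_inf p C f : R :=
  inf [set r | exists v c, C v c /\ r = p (f + v) - c].

Lemma sublinear0 p : sublinear p -> p 0 = 0.
Proof.
move=> [pD pZ]; have := pD 0 0; rewrite addr0 => h1.
have := pZ 2^-1 0; rewrite scaler0 invr_gt0 ltr0n => /(_ isT) h2.
lra.
Qed.

Lemma sublinear_oppr_ge p f : sublinear p -> - p (- f) <= p f.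
Proof.
by move=> sp; rewrite -subr_ge0 opprK -(sublinear0 sp) -{1}(subrr f); exact: sp.1.
Qed.

Lemma sublinear_shifted_inf p C : sublinear p -> convex_cone C ->
  (forall v c, C v c -> c <= p v) ->
  [/\ sublinear (shifted_inf p C), forall f, shifted_inf p C f <= p f &
    forall v c, C v c -> shifted_inf p C (- v) <= - c].
Proof.
move=> sp [C0 CD CZ] Cp.
pose E f := [set r | exists v c, C v c /\ r = p (f + v) - c].
have E0 f : E f !=set0 by exists (p (f + 0) - 0), 0, 0.
have lbE f v c : C v c -> shifted_inf p C f <= p (f + v) - c.
  move=> Cvc; apply: ge_inf; last by exists v, c.
  exists (- p (- f)) => _ [w [e [Cwe ->]]].
  have := Cp _ _ Cwe; have := sp.1 (f + w) (- f).
  rewrite addrAC subrr add0r; lra.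
split; [split| |].
- move=> f g; rewrite -lerBlDr; apply: (lb_le_inf (E0 _)) => _ [v [c [Cvc ->]]].
  rewrite lerBlDr -lerBlDl; apply: (lb_le_inf (E0 _)) => _ [w [e [Cwe ->]]].
  have := lbE (f + g) _ _ (CD _ _ _ _ Cvc Cwe).
  have := sp.1 (f + v) (g + w); rewrite addrACA; lra.
- move=> t f t0; rewrite -ler_pdivrMl //; apply: (lb_le_inf (E0 _)) => _ [v [c [Cvc ->]]].
  rewrite ler_pdivrMl //; apply: le_trans (lbE (t *: f) _ _ (CZ _ _ _ t0 Cvc)) _.
  by rewrite -scalerDr mulrBr lerD2r; exact: sp.2.
- by move=> f; apply: le_trans (lbE f _ _ C0) _; rewrite addr0 subr0.
- move=> v c Cvc; apply: le_trans (lbE (- v) _ _ Cvc) _.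
  by rewrite addNr sublinear0 // sub0r.
Qed.

(** Zorn's lemma: the pointwise infimum of a chain of sublinear functionals
    below [p] is finite, because each of them is at least [- p (- f)] at [f],
    and it is subadditive because a chain is directed. *)
Lemma minimal_sublinear p : sublinear p -> exists q,
  [/\ sublinear q, forall f, q f <= p f &
    forall q', sublinear q' -> (forall f, q' f <= q f) -> q' = q].
Proof.
move=> sp; pose T := {q : V -> R | sublinear q /\ forall f, q f <= p f}.
pose le (s t : T) := `[< forall f, sval t f <= sval s f >].
have [||||[q [sq qp]] qmin] := @Zorn T le.
- by move=> t; apply/asboolP.
- move=> r s t /asboolP rs /asboolP st; apply/asboolP => f.
  exact: le_trans (st f) (rs f).
- move=> [s Ps] [t Pt] /asboolP /= st /asboolP /= ts; apply: eq_exist.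
  by apply/funext => f; apply/eqP; rewrite eq_le st ts.
- move=> A Atot; have [[a Aa]|A0] := pselect (A !=set0); last first.
    have Pp : sublinear p /\ forall f, p f <= p f by [].
    by exists (exist _ p Pp) => s As; case: A0; exists s.
  pose E f := [set sval s f | s in A].
  have E0 f : E f !=set0 by exists (sval a f), a.
  have lbE f s : A s -> inf (E f) <= sval s f.
    move=> As; apply: ge_inf; last by exists s.
    exists (- p (- f)) => _ [[r /= [sr rp]] Ar <-] /=.
    by apply: le_trans (sublinear_oppr_ge f sr); rewrite lerN2.
  have Pm : sublinear (fun f => inf (E f)) /\ forall f, inf (E f) <= p f.
    split; last by move=> f; apply: le_trans (lbE f _ Aa) _; case: (a) => r [].
    split=> [f g|t f t0].
      rewrite -lerBlDr; apply: (lb_le_inf (E0 _)) => _ [s As <-].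
      rewrite lerBlDr -lerBlDl; apply: (lb_le_inf (E0 _)) => _ [r Ar <-].
      rewrite lerBlDl.
      have [/asboolP h|/asboolP h] := Atot _ _ As Ar.
        apply: le_trans (lbE _ _ Ar) _; apply: le_trans (_ : _ <= sval r f + sval r g) _.
          by case: (r) => ? [[]].
        by rewrite lerD2r.
      apply: le_trans (lbE _ _ As) _; apply: le_trans (_ : _ <= sval s f + sval s g) _.
        by case: (s) => ? [[]].
      by rewrite lerD2l.
    rewrite -ler_pdivrMl //; apply: (lb_le_inf (E0 _)) => _ [s As <-].
    rewrite ler_pdivrMl //; apply: le_trans (lbE _ _ As) _.
    by case: (s) => ? [[? h] ?] /=; exact: h.
  by exists (exist _ (fun f => inf (E f)) Pm) => s As; apply/asboolP => f /=; exact: lbE.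
exists q; split=> // q' sq' q'q.
have Pq' : sublinear q' /\ forall f, q' f <= p f.
  by split=> // f; exact: le_trans (q'q f) (qp f).
have := qmin (exist _ q' Pq'); rewrite /le asboolE /= => /(_ q'q).
by move=> /(congr1 sval).
Qed.

(** Shifting along the ray of [g] with values [t * q g] produces a sublinear
    functional below [q] that is at most [- q g] at [- g].  By minimality it is
    [q] itself, so [q] is odd, and an odd sublinear functional is linear. *)
Lemma minimal_sublinear_scalar q : sublinear q ->
  (forall q', sublinear q' -> (forall f, q' f <= q f) -> q' = q) -> scalar q.
Proof.
move=> sq qmin; have qN g : q (- g) = - q g.
  pose C v c := exists2 t, 0 <= t & v = t *: g /\ c = t * q g.
  have coneC : convex_cone C; first split.
  - by exists 0 => //; rewrite scale0r mul0r.
  - move=> _ _ _ _ [t t0 [-> ->]] [s s0 [-> ->]].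
    by exists (t + s); rewrite ?addr_ge0 // scalerDl mulrDl.
  - move=> s _ _ s0 [t t0 [-> ->]].
    by exists (s * t); [rewrite mulr_ge0 // ltW|rewrite scalerA mulrA].
  have Cq v c : C v c -> c <= q v.
    move=> [t]; rewrite le_eqVlt => /predU1P[<-|t0] [-> ->].
      by rewrite scale0r mul0r sublinear0.
    rewrite -ler_pdivlMl // -{1}(scale1r g) -(mulVf (lt0r_neq0 t0)) -scalerA.
    by apply: sq.2; rewrite invr_gt0.
  have [sC Cle CN] := sublinear_shifted_inf sq coneC Cq.
  apply/eqP; rewrite eq_le; apply/andP; split; last first.
    by rewrite lerNl; exact: sublinear_oppr_ge.
  rewrite -[in leLHS](qmin _ sC Cle); apply: CN.
  by exists 1 => //; rewrite scale1r mul1r.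
have qD f g : q (f + g) = q f + q g.
  apply/eqP; rewrite eq_le sq.1 /=.
  by rewrite -[leRHS]opprK -qN opprD lerNr opprD -!qN; exact: sq.1.
have qZ t f : 0 < t -> q (t *: f) = t * q f.
  move=> t0; apply/eqP; rewrite eq_le sq.2 //=.
  by rewrite -[leRHS]opprK -qN -scalerN lerNr -mulrN -qN; exact: sq.2.
move=> t f g; rewrite qD; congr (_ + _).
have [t0|t0|->] := ltrgtP t 0; last by rewrite scale0r mul0r sublinear0.
  by rewrite -[t]opprK scaleNr qN qZ ?oppr_gt0 // [RHS]mulNr.
by rewrite qZ.
Qed.

(** A form of the Hahn-Banach theorem: a linear functional fits between the
    lower bounds prescribed on a cone and a sublinear upper bound.  Any minimal
    sublinear functional below [shifted_inf p C] will do. *)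
Lemma Mazur_Orlicz p C : sublinear p -> convex_cone C ->
  (forall v c, C v c -> c <= p v) ->
  exists L, [/\ scalar L, forall f, L f <= p f & forall v c, C v c -> c <= L v].
Proof.
move=> sp coneC Cp; have [sC Cle CN] := sublinear_shifted_inf sp coneC Cp.
have [L [sL LC Lmin]] := minimal_sublinear sC.
have linL := minimal_sublinear_scalar sL Lmin.
exists L; split=> // [f|v c Cvc]; first exact: le_trans (LC f) (Cle f).
have LN : L (- v) = - L v.
  by have := linL (-1) v 0; rewrite addr0 scaleN1r mulN1r sublinear0 // addr0.
by rewrite -lerN2 -LN; exact: le_trans (LC _) (CN _ _ Cvc).
Qed.

End mazur_orlicz.

(** * Integrals of bounded measurable functions *)

Section bounded_measurable.
Context (R : realType) (d : measure_display) (T : measurableType d).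
Implicit Types (u v : T -> R) (A : set T).

Definition bounded_measurable u :=
  measurable_fun setT u /\ exists M : R, forall x, `|u x| <= M.

Lemma bounded_measurable_integrable (m : {finite_measure set T -> \bar R}) u :
  bounded_measurable u -> m.-integrable setT (EFin \o u).
Proof.
move=> [mu [M uM]]; apply: measurable_bounded_integrable => //.
  by rewrite ltey_eq fin_num_measure.
exists M; split=> [|y My x _] /=; first exact: num_real.
exact: le_trans (uM x) (ltW My).
Qed.

Lemma bounded_measurable_cst (a : R) : bounded_measurable (cst a).
Proof. by split; [exact: measurable_cst|exists `|a|]. Qed.

Lemma bounded_measurableD u v : bounded_measurable u -> bounded_measurable v ->
  bounded_measurable (fun x => u x + v x).
Proof.
move=> [mu [M uM]] [mv [N vN]]; split; first exact: measurable_funD.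
by exists (M + N) => x; apply: le_trans (ler_normD _ _) _; exact: lerD.
Qed.

Lemma bounded_measurableZ (a : R) u : bounded_measurable u ->
  bounded_measurable (fun x => a * u x).
Proof.
move=> [mu [M uM]]; split; first by apply: measurable_funM => //; exact: measurable_cst.
by exists (`|a| * M) => x; rewrite normrM ler_wpM2l.
Qed.

Lemma bounded_measurableB u v : bounded_measurable u -> bounded_measurable v ->
  bounded_measurable (fun x => u x - v x).
Proof.
move=> bu /(bounded_measurableZ (-1)) /(bounded_measurableD bu); congr bounded_measurable.
by apply/funext => x; rewrite mulN1r.
Qed.

Lemma bounded_measurable_indic A : measurable A ->
  bounded_measurable (\1_A : T -> R).
Proof.
move=> mA; split; first exact: measurable_indic.
by exists 1 => x; rewrite indicE; case: (_ \in _); rewrite ?normr1 ?normr0 ?ler01.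
Qed.

Lemma bounded_measurable_pos u : bounded_measurable u ->
  bounded_measurable (fun x => Num.max (u x) 0).
Proof.
move=> [mu [M uM]]; split; first by apply: measurable_maxr => //; exact: measurable_cst.
exists M => x; apply: le_trans (uM x); rewrite /Num.max; case: ifP => _ //.
by rewrite normr0.
Qed.

Lemma bounded_measurable_floor u : bounded_measurable u ->
  bounded_measurable (fun x => (Num.floor (u x))%:~R).
Proof.
move=> [mu [M uM]]; split.
  have mfl : measurable_fun setT (fun r : R => (Num.floor r)%:~R : R).
    by apply: nondecreasing_measurable => // x y xy; rewrite ler_int le_floor.
  exact: (measurableT_comp mfl mu).
exists (M + 1) => x; have := uM x.
have := floor_le (u x); have := floorD1_gt (u x).
rewrite intrD; rewrite !ler_norml; move=> h1 h2 /andP[h3 h4].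
apply/andP; split; lra.
Qed.

Lemma Rintegral_indic (m : {finite_measure set T -> \bar R}) A : measurable A ->
  \int[m]_x (\1_A x) = fine (m A).
Proof. by move=> mA; rewrite /Rintegral integral_indic // setIT. Qed.

End bounded_measurable.

Lemma bounded_measurable_comp (R : realType) (d1 d2 : measure_display)
    (T1 : measurableType d1) (T2 : measurableType d2) (g : T1 -> T2) (u : T2 -> R) :
  measurable_fun setT g -> bounded_measurable u -> bounded_measurable (fun x => u (g x)).
Proof.
by move=> mg [mu [M uM]]; split; [exact: measurableT_comp|exists M].
Qed.

(** * The coarea inequality *)

Section coarea.
Context (R : realType) (d : measure_display) (T : measurableType d).
Context (m : {finite_measure set (T * T)%type -> \bar R}).
Context (l p : {finite_measure set T -> \bar R}).
Context (lpm : forall X, measurable X ->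
  fine (l X) <= fine (p X) + fine (m (X `*` ~` X))).
Context (lpT : l setT = p setT).
Implicit Types (u : T -> R).

Let Iu (n : {finite_measure set T -> \bar R}) u : bounded_measurable u ->
  n.-integrable setT (EFin \o u).
Proof. exact: bounded_measurable_integrable. Qed.

Lemma bounded_measurable_cut u : bounded_measurable u ->
  bounded_measurable (fun z : (T * T)%type => Num.max (u z.1 - u z.2) 0).
Proof.
move=> bu; apply: bounded_measurable_pos; apply: bounded_measurableB.
  exact: bounded_measurable_comp measurable_fst bu.
exact: bounded_measurable_comp measurable_snd bu.
Qed.

(** For integer-valued [u], peel off the indicator of [A = {u > 0}]: the
    positive part of [u x - u y] drops by the indicator of [A `*` ~` A], so
    that each step costs one instance of [lpm]. *)
Let coarea_nat (n : nat) u : bounded_measurable u ->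
  (forall x, exists2 k, (k <= n)%N & u x = k%:R) ->
  \int[l]_x u x <= \int[p]_x u x + \int[m]_z Num.max (u z.1 - u z.2) 0.
Proof.
elim: n u => [|n IH] u bu un.
  have u0 x : u x = 0 by have [[|k]] := un x.
  rewrite (@eq_Rintegral _ _ _ l setT (cst 0)) => [|x _]; last by rewrite u0.
  rewrite (@eq_Rintegral _ _ _ p setT (cst 0)) => [|x _]; last by rewrite u0.
  rewrite (@eq_Rintegral _ _ _ m setT (cst 0)) => [|x _]; last by rewrite !u0 subr0 maxxx.
  by rewrite !Rintegral_cst // !mul0r addr0.
pose A := [set x | 0 < u x].
have mA : measurable A.
  have -> : A = setT `&` u @^-1` `]0, +oo[%classic.
    by rewrite setTI preimage_itvoy.
  by apply: bu.1 => //; exact: measurable_itv.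
have mAA : measurable (A `*` ~` A).
  by apply: measurableX => //; exact: measurableC.
pose u' x := u x - \1_A x.
have b1 : bounded_measurable (\1_A : T -> R) by exact: bounded_measurable_indic.
have bu' : bounded_measurable u' by exact: bounded_measurableB.
have un' x : exists2 k, (k <= n)%N & u' x = k%:R.
  have [k kn uk] := un x; rewrite /u' indicE.
  have [xA|xA] := boolP (x \in A); move: xA; rewrite ?inE ?notin_setE /A /= uk.
    by case: k kn {uk} => [|k] kn; [rewrite ltxx|exists k => //; rewrite -natr1 addrK].
  move/negP; rewrite -leNgt; case: k kn {uk} => [|k] kn; first by exists 0%N; rewrite ?subr0.
  by rewrite lern0.
have uE x : u x = u' x + \1_A x by rewrite /u' subrK.
have u'0 t : 0 <= u' t by have [i _ ->] := un' t; exact: ler0n.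
have u'1 t : ~ A t -> u' t = 0.
  move=> At; rewrite /u' indicE memNset // subr0.
  have [i _ ut] := un t; apply/eqP; rewrite eq_le; move: At; rewrite /A /= ut ler0n andbT.
  by move/negP; rewrite -leNgt.
clearbody u'.
have cutE z : Num.max (u z.1 - u z.2) 0 =
    Num.max (u' z.1 - u' z.2) 0 + \1_(A `*` ~` A) z.
  case: z => x y /=.
  rewrite (uE x) (uE y) !indicE in_setX in_setC /=.
  have [xA|xA] := boolP (x \in A); have [yA|yA] := boolP (y \in A) => /=.
  - by rewrite addr0 opprD addrACA subrr addr0.
  - rewrite (u'1 y); last by rewrite notin_setE in yA.
    by have := u'0 x => ux0; rewrite !max_l; lra.
  - rewrite (u'1 x); last by rewrite notin_setE in xA.
    by have := u'0 y => uy0; rewrite !max_r; lra.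
  - by rewrite !addr0.
under eq_Rintegral do rewrite uE.
under [X in _ <= X + _]eq_Rintegral do rewrite uE.
under [X in _ <= _ + X]eq_Rintegral do rewrite cutE.
have bc := bounded_measurable_cut bu'.
have bA : bounded_measurable (\1_(A `*` ~` A) : (T * T)%type -> R).
  exact: bounded_measurable_indic.
rewrite !RintegralD //; try exact: bounded_measurable_integrable.
rewrite !Rintegral_indic // addrACA; apply: lerD; last exact: lpm.
exact: IH.
Qed.

(** The case of a bounded [u] follows by rounding [v = n (u + M)] down to
    integers: all integrals change by at most a constant independent of [n],
    while the inequality for [v] is [n] times the one for [u], because it is
    homogeneous and invariant under translation ([lpT]). *)
Lemma coarea u : bounded_measurable u ->
  \int[l]_x u x <= \int[p]_x u x + \int[m]_z Num.max (u z.1 - u z.2) 0.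
Proof.
move=> bu; have bc := bounded_measurable_cut bu.
have [mu [M uM]] := bu.
set G := \int[p]_x u x + _; pose C := fine (m setT) + fine (l setT).
suff main (n : nat) : n%:R * (\int[l]_x u x - G) <= C.
  rewrite leNgt -subr_gt0; apply/negP => G0.
  have := main (Num.trunc (C / (\int[l]_x u x - G))).+1.
  by rewrite leNgt -ltr_pdivrMr // truncnS_gt.
pose v x := n%:R * u x + n%:R * M.
have bv : bounded_measurable v.
  apply: bounded_measurableD; first exact: bounded_measurableZ.
  exact: bounded_measurable_cst.
have v0 x : 0 <= v x.
  rewrite /v -mulrDr mulr_ge0 // -lerBlDr sub0r.
  by have := uM x; rewrite ler_norml => /andP[].
pose w x : R := (Num.floor (v x))%:~R.
have bw : bounded_measurable w by exact: bounded_measurable_floor.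
have [_ [N vN]] := bv.
have wv x : w x <= v x by exact: floor_le.
have vw x : v x <= w x + 1 by rewrite ltW // -intrD1 floorD1_gt.
have hw : \int[l]_x w x <= \int[p]_x w x + \int[m]_z Num.max (w z.1 - w z.2) 0.
  apply: (@coarea_nat (Num.trunc N).+1) => // x.
  have : 0 <= Num.floor (v x) by rewrite floor_ge0.
  rewrite /w; have := wv x; rewrite /w; case: (Num.floor (v x)) => // k kv _.
  exists k => //; rewrite ltnW // -(ltr_nat R).
  apply: le_lt_trans (truncnS_gt N); apply: le_trans kv _.
  by apply: le_trans (vN x); exact: ler_norm.
have cwv : \int[m]_z Num.max (w z.1 - w z.2) 0 <=
    \int[m]_z (Num.max (v z.1 - v z.2) 0 + 1).
  apply: le_Rintegral => //.
  - by apply: bounded_measurable_integrable; exact: bounded_measurable_cut.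
  - apply: bounded_measurable_integrable; apply: bounded_measurableD.
      exact: bounded_measurable_cut.
    exact: bounded_measurable_cst.
  - move=> [x y] _ /=; have := wv x; have := vw y.
    have : v x - v y <= Num.max (v x - v y) 0 by rewrite le_max lexx.
    have : 0 <= Num.max (v x - v y) 0 by rewrite le_max lexx orbT.
    by rewrite ge_max => *; apply/andP; split; lra.
have lvw : \int[l]_x v x <= \int[l]_x (w x + 1).
  apply: le_Rintegral => //; first exact: Iu.
  by apply: Iu; apply: bounded_measurableD => //; exact: bounded_measurable_cst.
have pwv : \int[p]_x w x <= \int[p]_x v x by apply: le_Rintegral => //; exact: Iu.
have i1 : l.-integrable setT (EFin \o cst 1) by apply: Iu; exact: bounded_measurable_cst.
have i1' : m.-integrable setT (EFin \o cst 1).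
  by apply: bounded_measurable_integrable; exact: bounded_measurable_cst.
have icv := bounded_measurable_integrable m (bounded_measurable_cut bv).
have lE : \int[l]_x (w x + 1) = \int[l]_x w x + fine (l setT).
  by rewrite (RintegralD measurableT (Iu l bw) i1) Rintegral_cst // mul1r.
have mE : \int[m]_z (Num.max (v z.1 - v z.2) 0 + 1) =
    \int[m]_z Num.max (v z.1 - v z.2) 0 + fine (m setT).
  by rewrite (RintegralD measurableT icv i1') Rintegral_cst // mul1r.
have cv : \int[m]_z Num.max (v z.1 - v z.2) 0 =
    n%:R * \int[m]_z Num.max (u z.1 - u z.2) 0.
  rewrite -RintegralZl //; last exact: bounded_measurable_integrable.
  apply: eq_Rintegral => z _; rewrite maxr_pMr ?ler0n // mulr0; congr Num.max.
  by rewrite /v opprD addrACA subrr addr0 mulrBr.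
have vE (k : {finite_measure set T -> \bar R}) :
    \int[k]_x v x = n%:R * \int[k]_x u x + n%:R * M * fine (k setT).
  rewrite RintegralD //; last 2 first.
  - by apply: Iu; exact: bounded_measurableZ.
  - by apply: Iu; exact: bounded_measurable_cst.
  by rewrite RintegralZl ?Rintegral_cst //; exact: Iu.
move: cwv lvw pwv hw; rewrite lE mE cv !vE /G /C lpT mulrBr mulrDr; lra.
Qed.

End coarea.

(** * Measures with a prescribed boundary *)

Section flow_existence.
Context (R : realType) (d : measure_display) (T : measurableType d).
Context (m : {finite_measure set (T * T)%type -> \bar R}).

Let V := @LfunType _ _ R m 1%E (lexx 1%E).

(** The value on nonmeasurable sets is a junk value; [insubd] avoids carrying a
    proof of measurability inside the function that becomes [nu]. *)
Let indic_Lfun (E : set (T * T)) : V := insubd (0 : V) (\1_E : T * T -> R).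

Let indic_LfunE E z : measurable E -> indic_Lfun E z = \1_E z.
Proof.
move=> mE; rewrite /indic_Lfun val_insubd ifT //.
apply/Lfun1_integrable; apply: bounded_measurable_integrable.
exact: bounded_measurable_indic.
Qed.

Let Lfun_int (f : V) : m.-integrable setT (EFin \o f).
Proof. by apply/Lfun1_integrable; exact: LfunP. Qed.

Let ipos (f : V) : R := \int[m]_z Num.max (f z) 0.

Let sublinear_ipos : sublinear ipos.
Proof.
have ip (f : V) : m.-integrable setT (EFin \o (fun z => Num.max (f z) 0)).
  exact: integrable_funrpos (Lfun_int f).
split=> [f g|t f t0].
  rewrite /ipos -RintegralD //; apply: le_Rintegral => //.
    exact: (integrableD measurableT (ip f) (ip g)).
  move=> z _; rewrite ge_max; apply/andP; split.
    by apply: lerD; rewrite le_max lexx.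
  by apply: addr_ge0; rewrite le_max lexx orbT.
rewrite /ipos -RintegralZl //; apply: le_Rintegral => //.
  exact: (integrableZl measurableT t (ip f)).
by move=> z _; rewrite (maxr_pMr _ _ (ltW t0)) mulr0.
Qed.

(** A measurable version of Hoffman's supply-demand theorem.  The cut
    condition, for [X] and its complement, bounds [`|delta|] by the sum [mp] of
    the two marginals of [m]; this makes [delta] countably additive, and
    integration against it becomes the difference of the integrals against the
    measures [l = delta + mp] and [p = mp]. *)
Lemma Hoffman (delta : set T -> R) :
  (forall X Y, measurable X -> measurable Y -> X `&` Y = set0 ->
     delta (X `|` Y) = delta X + delta Y) ->
  (forall X, measurable X -> delta X <= fine (m (X `*` ~` X))) ->
  delta setT = 0 ->
  exists nu : set (T * T) -> R, [/\ signed_measure nu,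
    forall E, measurable E -> 0 <= nu E,
    forall E, measurable E -> nu E <= fine (m E) &
    forall X, measurable X -> nu (X `*` setT) - nu (setT `*` X) = delta X].
Proof.
move=> deltaU deltam deltaT.
have sm := signed_measure_finite_measure m.
have m_ge0 E : 0 <= fine (m E) by exact: fine_ge0.
have m_le E F : measurable E -> measurable F -> E `<=` F -> fine (m E) <= fine (m F).
  move=> mE mF EF; apply: fine_le; rewrite ?fin_num_measure //.
  by apply: le_measure; rewrite ?inE.
pose mp X := fine (m (fst @^-1` X)) + fine (m (snd @^-1` X)).
have smp : signed_measure mp.
  apply: signed_measureD.
    exact: (signed_measure_pushforward (@measurable_fst _ _ T T) sm).
  exact: (signed_measure_pushforward (@measurable_snd _ _ T T) sm).
have mfst X : measurable X -> measurable (fst @^-1` X : set (T * T)).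
  by move=> mX; rewrite -[X in measurable X]setTI; exact: measurable_fst.
have msnd X : measurable X -> measurable (snd @^-1` X : set (T * T)).
  by move=> mX; rewrite -[X in measurable X]setTI; exact: measurable_snd.
have mXC (X : set T) : measurable X -> measurable (X `*` ~` X).
  by move=> mX; apply: measurableX => //; exact: measurableC mX.
have mCX (X : set T) : measurable X -> measurable (~` X `*` X).
  by move=> mX; apply: measurableX => //; exact: measurableC mX.
have delta_mp X : measurable X -> `|delta X| <= mp X.
  move=> mX; have mX' := measurableC mX.
  have := deltaU _ _ mX mX' (setICr X); rewrite setUv deltaT => h.
  have h1 := deltam _ mX; have h2 := deltam _ mX'; rewrite setCK in h2.
  have h3 : fine (m (X `*` ~` X)) <= fine (m (fst @^-1` X)).
    by apply: m_le => //; [exact: mXC|exact: mfst|move=> z []].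
  have h4 : fine (m (~` X `*` X)) <= fine (m (snd @^-1` X)).
    by apply: m_le => //; [exact: mCX|exact: msnd|move=> z []].
  rewrite /mp ler_norml; have := m_ge0 (fst @^-1` X); have := m_ge0 (snd @^-1` X).
  by move=> *; apply/andP; split; lra.
have sdelta := signed_measure_dominated deltaU smp delta_mp.
have [p pE] : exists p : {finite_measure set T -> \bar R},
    forall X, measurable X -> p X = (mp X)%:E.
  apply: finite_measure_of_signed_measure => // X mX.
  exact: le_trans (normr_ge0 _) (delta_mp X mX).
have [l lE] : exists l : {finite_measure set T -> \bar R},
    forall X, measurable X -> l X = (delta X + mp X)%:E.
  apply: finite_measure_of_signed_measure; first exact: signed_measureD.
  by move=> X mX; have := delta_mp X mX; rewrite ler_norml => /andP[]; lra.
have lpm X : measurable X -> fine (l X) <= fine (p X) + fine (m (X `*` ~` X)).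
  by move=> mX; rewrite lE // pE //= addrC lerD2l deltam.
have lpT : l setT = p setT by rewrite lE // pE // deltaT add0r.
(* [C] is a linear subspace, so the lower bounds given by [Mazur_Orlicz] are
   in fact equalities. *)
pose C (v : V) (c : R) := exists u, [/\ bounded_measurable u,
  forall z, v z = u z.1 - u z.2 & c = \int[l]_x u x - \int[p]_x u x].
have Iu (k : {finite_measure set T -> \bar R}) u : bounded_measurable u ->
  k.-integrable setT (EFin \o u) by exact: bounded_measurable_integrable.
have coneC : convex_cone C.
  split.
  - exists (cst 0); split=> [|z|]; first exact: bounded_measurable_cst.
      by rewrite subrr.
    by rewrite !Rintegral_cst // !mul0r subrr.
  - move=> v w _ _ [u [bu vu ->]] [t [bt wt ->]]; exists (fun x => u x + t x).
    split=> [|z|]; first exact: bounded_measurableD.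
      by rewrite opprD addrACA -vu -wt.
    by rewrite !RintegralD //; try exact: Iu; rewrite opprD addrACA.
  - move=> t v _ t0 [u [bu vu ->]]; exists (fun x => t * u x).
    split=> [|z|]; first exact: bounded_measurableZ.
      by rewrite -mulrBr -vu.
    by rewrite !RintegralZl ?mulrBr //; exact: Iu.
have Cpos v c : C v c -> c <= ipos v.
  move=> [u [bu vu ->]]; rewrite lerBlDl.
  have -> : ipos v = \int[m]_z Num.max (u z.1 - u z.2) 0.
    by apply: eq_Rintegral => z _; rewrite vu.
  exact: coarea.
have [L [Llin Lpos LC]] := Mazur_Orlicz sublinear_ipos coneC Cpos.
have LD f g : L (f + g) = L f + L g by have := Llin 1 f g; rewrite scale1r mul1r.
have L0 : L 0 = 0 by have := LD 0 0; rewrite addr0; lra.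
have LN f : L (- f) = - L f by have := LD f (- f); rewrite subrr L0; lra.
pose nu E := L (indic_Lfun E).
have nu_ge0 E : measurable E -> 0 <= nu E.
  move=> mE; rewrite -oppr_le0 -LN; apply: le_trans (Lpos _) _.
  rewrite /ipos (_ : \int[m]_z _ = \int[m]_z cst 0 z).
    by rewrite Rintegral_cst // mul0r.
  apply: eq_Rintegral => z _.
  rewrite (_ : (- indic_Lfun E) z = - \1_E z); last by rewrite -indic_LfunE.
  by apply/max_idPr; rewrite oppr_le0 indicE ler0n.
have nu_le E : measurable E -> nu E <= fine (m E).
  move=> mE; apply: le_trans (Lpos _) _; rewrite /ipos -Rintegral_indic //.
  rewrite (_ : \int[m]_z _ = \int[m]_z \1_E z) //.
  apply: eq_Rintegral => z _; rewrite indic_LfunE //.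
  by apply/max_idPl; rewrite indicE ler0n.
have nuU E F : measurable E -> measurable F -> E `&` F = set0 ->
    nu (E `|` F) = nu E + nu F.
  move=> mE mF EF; rewrite /nu -LD; congr L; apply/LfuneqP => z.
  transitivity (indic_Lfun E z + indic_Lfun F z); last by [].
  rewrite !indic_LfunE //; last exact: measurableU.
  have [Ez|Ez] := pselect (E z).
    have nFz : ~ F z by move=> Fz; have : (E `&` F) z by []; rewrite EF.
    by rewrite !indicE in_setU (mem_set Ez) (memNset nFz) addr0.
  by rewrite !indicE in_setU (memNset Ez) add0r.
exists nu; split=> //.
  apply: signed_measure_dominated nuU sm _ => E mE.
  by rewrite ger0_norm ?nu_ge0 // nu_le.
move=> X mX; have mXT : measurable (X `*` [set: T]) by exact: measurableX.
have mTX : measurable ([set: T] `*` X) by exact: measurableX.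
have bX : bounded_measurable (\1_X : T -> R) by exact: bounded_measurable_indic.
have dX : \int[l]_x \1_X x - \int[p]_x \1_X x = delta X.
  by rewrite !Rintegral_indic // lE // pE //= addrK.
have indX z : indic_Lfun (X `*` setT) z - indic_Lfun (setT `*` X) z =
    \1_X z.1 - \1_X z.2.
  by rewrite !indic_LfunE // !indicE !in_setX !in_setT andbT.
have le1 : delta X <= L (indic_Lfun (X `*` setT) - indic_Lfun (setT `*` X)).
  by apply: LC; exists (\1_X); split=> // z; rewrite -indX.
have le2 : - delta X <= L (indic_Lfun (setT `*` X) - indic_Lfun (X `*` setT)).
  apply: LC; exists (fun x => - 1 * \1_X x); split.
  - exact: bounded_measurableZ.
  - by move=> z; rewrite -mulrBr -indX mulN1r opprB.
  - by rewrite !RintegralZl ?Iu // -mulrBr dX mulN1r.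
move: le1 le2; rewrite !LD !LN -/(nu _) -/(nu (setT `*` X)) => le1 le2.
lra.
Qed.


End flow_existence.

(** * Transposition, reduction and antisymmetric measures *)

Section skew_part.
Context (R : realType) (d : measure_display) (T : measurableType d).
Implicit Types (f g a b c e : set (T * T) -> R) (E H : set (T * T)) (X : set T).

(** This form makes [transpose f] convertible to [f \o tr]. *)
Definition tr E : set (T * T) := [set p | E (p.2, p.1)].

Definition skewpart f E := f E - f (tr E).

Definition antisymmetric_measure a :=
  signed_measure a /\ forall E, measurable E -> a (tr E) = - a E.

Lemma trK E : tr (tr E) = E.
Proof. by apply/funext => -[x y]. Qed.

Lemma measurable_tr E : measurable E -> measurable (tr E).
Proof.
by move=> mE; rewrite -[X in measurable X]setTI; exact: (@measurable_swap _ _ T T).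
Qed.

Lemma tr_setX (A B : set T) : tr (A `*` B) = B `*` A.
Proof. by apply/seteqP; split=> -[x y] /= []. Qed.

Lemma signed_measure_tr f : signed_measure f -> signed_measure (f \o tr).
Proof. exact: (signed_measure_pushforward (@measurable_swap _ _ T T)). Qed.

Lemma antisymmetric_skew f : signed_measure f -> antisymmetric_measure (skewpart f).
Proof.
move=> sf; split; first exact: (signed_measureB sf (signed_measure_tr sf)).
by move=> E _; rewrite /skewpart trK opprB.
Qed.

Lemma measurable_rect (A B : set T) : measurable A -> measurable B ->
  measurable (A `*` B).
Proof. exact: measurableX. Qed.

Lemma measurable_cut X : measurable X -> measurable (X `*` ~` X).
Proof. by move=> mX; apply: measurable_rect => //; exact: measurableC. Qed.

(** [X `*` X] is its own transpose, so [a] vanishes on it. *)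
Lemma antisymmetric_cut a X : antisymmetric_measure a -> measurable X ->
  a (X `*` ~` X) = a (X `*` setT).
Proof.
move=> [sa aN] mX; have mXX := measurable_rect mX mX.
have aXX : a (X `*` X) = 0 by have := aN _ mXX; rewrite tr_setX; lra.
have -> : X `*` setT = (X `*` X) `|` (X `*` ~` X).
  apply/seteqP; split=> -[x y] /=; last by case=> -[].
  by move=> [Xx _]; have [?|?] := pselect (X y); [left|right].
rewrite signed_measureU ?aXX ?add0r //; first exact: measurable_cut.
by apply/seteqP; split=> -[x y] //= [[_ ?] []].
Qed.

(** The positive part [f] of [a], with [f^*] its negative part.  A Hahn set [H]
    and its transpose need not be complementary; but [a] vanishes on the
    measurable subsets of [H `&` tr H] and of the complement of [H `|` tr H],
    where it has the same sign as its transpose, so [H `\` tr H] can be used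
    instead. *)
Lemma antisymmetric_jordan a : antisymmetric_measure a ->
  exists f, [/\ signed_measure f, forall E, measurable E -> 0 <= f E,
    forall E, measurable E -> skewpart f E = a E,
    eq_meas (meet (EFin \o f) (transpose (EFin \o f))) (cst 0%E) &
    forall b, signed_measure b -> (forall E, measurable E -> 0 <= b E) ->
      (forall E, measurable E -> a E <= b E) ->
      forall E, measurable E -> f E <= b E].
Proof.
move=> [sa aN]; have [H [mH H0 H1]] := Hahn sa.
pose K := H `&` ~` tr H.
have mK : measurable K by apply: measurableI => //; apply: measurableC; exact: measurable_tr.
have mI E F : measurable E -> measurable F -> measurable (E `&` F).
  exact: measurableI.
have mtK := measurable_tr mK.
have a_rest E : measurable E -> a (E `&` ~` K `&` ~` tr K) = 0.
  move=> mE; set Z := _ `&` ~` tr K.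
  have mZ : measurable Z by apply: (mI _ _ (mI _ _ mE _) _); exact: measurableC.
  rewrite (signed_measureID sa mZ mH).
  have mZH := mI _ _ mZ mH; have mZH' := mI _ _ mZ (measurableC mH).
  have h1 : 0 <= a (Z `&` H) by apply: H0 => //; exact: subIsetr.
  have h2 : a (Z `&` ~` H) <= 0 by apply: H1 => //; exact: subIsetr.
  have h3 : 0 <= a (tr (Z `&` H)).
    apply: H0; first exact: measurable_tr.
    by move=> [x y] [[[_ /= nK] _] Hyx]; apply: contrapT => nH; apply: nK.
  have h4 : a (tr (Z `&` ~` H)) <= 0.
    apply: H1; first exact: measurable_tr.
    by move=> [x y] [[_ /= nK] nH] Hxy; apply: nK.
  move: h3 h4; rewrite !aN //; lra.
pose f E := a (E `&` K).
have sf : signed_measure f by exact: signed_measure_restr.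
have f0 E : measurable E -> 0 <= f E.
  by move=> mE; apply: H0; [exact: mI|move=> z [_ []]].
have fK E : measurable E -> f (E `&` ~` K) = 0.
  by move=> mE; rewrite /f -setIA setICl setI0 sa.1.
have ftK E : measurable E -> f (tr (E `&` K)) = 0.
  move=> mE; rewrite /f (_ : _ `&` K = set0) ?sa.1 //.
  by apply/seteqP; split=> -[x y] //= [[_ [Hyx _]] [_ nHyx]].
exists f; split=> //.
- move=> E mE; rewrite /skewpart /f.
  have -> : tr E `&` K = tr (E `&` tr K) by apply/seteqP; split=> -[].
  rewrite aN ?opprK; last exact: mI.
  rewrite (signed_measureID sa mE mK); congr (_ + _).
  have mEK := mI _ _ mE (measurableC mK).
  rewrite (signed_measureID sa mEK mtK) a_rest // addr0; congr a.
  apply/seteqP; split=> -[x y] /=; last by move=> [[]].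
  by move=> [Exy [Hyx nHxy]]; split=> //; split=> // -[].
- have [c [sc cE cf cft cmax]] := meetP sf (signed_measure_tr sf).
  move=> E mE; transitivity ((EFin \o c) E); first exact: cE.
  rewrite /=; congr EFin; apply/eqP; rewrite eq_le; apply/andP; split.
    rewrite (signed_measureID sc mE mK).
    have := cft _ (mI _ _ mE mK); rewrite /= ftK // => ?.
    have := cf _ (mI _ _ mE (measurableC mK)); rewrite fK // => ?; lra.
  apply: (cmax (cst 0)) => // [|X mX]; first exact: signed_measure_cst0.
  by apply: f0; exact: measurable_tr.
- move=> b sb b0 ab E mE; rewrite (signed_measureID sb mE mK).
  have mEK := mI _ _ mE mK; have := ab _ mEK.
  by have := b0 _ (mI _ _ mE (measurableC mK)); rewrite /f; lra.
Qed.

(** Symmetry of [f /\ f^*] comes from its being the greatest lower bound. *)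
Lemma meet_transpose f : signed_measure f -> exists c,
  [/\ signed_measure c,
    eq_meas (meet (EFin \o f) (transpose (EFin \o f))) (EFin \o c),
    forall E, measurable E -> c (tr E) = c E,
    forall E, measurable E -> c E <= f E &
    forall h, signed_measure h -> (forall E, measurable E -> h E <= f E) ->
      (forall E, measurable E -> h E <= f (tr E)) ->
      forall E, measurable E -> h E <= c E].
Proof.
move=> sf; have [c [sc cE cf cft cmax]] := meetP sf (signed_measure_tr sf).
have ctr E : measurable E -> c (tr E) <= c E.
  apply: (cmax (c \o tr)); first exact: signed_measure_tr.
    by move=> F mF; have := cft _ (measurable_tr mF); rewrite /= trK.
  by move=> F mF; exact: (cf _ (measurable_tr mF)).
exists c; split=> // E mE; apply/eqP; rewrite eq_le ctr //=.
by have := ctr _ (measurable_tr mE); rewrite trK.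
Qed.

Lemma eq_meas_transpose (f g : set (T * T) -> \bar R) : eq_meas f g ->
  eq_meas (transpose f) (transpose g).
Proof. by move=> fg E mE; exact: (fg _ (measurable_tr mE)). Qed.

Lemma eq_meas_reduction (f g : set (T * T) -> \bar R) : eq_meas f g ->
  eq_meas (reduction f) (reduction g).
Proof.
move=> fg E mE; rewrite /reduction (eq_meet fg (eq_meas_transpose fg)) /=.
by rewrite fg.
Qed.

Lemma reductionP f : signed_measure f -> exists p, [/\ signed_measure p,
  eq_meas (reduction (EFin \o f)) (EFin \o p) &
  forall E, measurable E -> skewpart p E = skewpart f E].
Proof.
move=> sf; have [c [sc cE ctr cf cmax]] := meet_transpose sf.
exists (fun E => f E - c E); split; first exact: signed_measureB.
  by move=> E mE; rewrite /reduction /= cE.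
by move=> E mE; rewrite /skewpart ctr //; lra.
Qed.

(** For the converse, if [a - a^* = b - b^*] then [b - a] is symmetric, so
    [c + (b - a)] is a common lower bound of [b] and [b^*] whenever [c] is one
    of [a] and [a^*].  Exchanging [a] and [b], the meets differ exactly by
    [b - a]. *)
Lemma red_equivP (f g : set (T * T) -> \bar R) a b :
  signed_measure a -> signed_measure b ->
  eq_meas f (EFin \o a) -> eq_meas g (EFin \o b) ->
  red_equiv f g <-> forall E, measurable E -> skewpart a E = skewpart b E.
Proof.
move=> sa sb fa gb.
have [c [sc cE ct ca cmax]] := meet_transpose sa.
have [e [se eE et eb emax]] := meet_transpose sb.
split=> [fg|ab].
  have [p [sp pE pa]] := reductionP sa; have [q [sq qE qb]] := reductionP sb.
  move=> E mE; rewrite -pa // -qb //.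
  have pq F : measurable F -> p F = q F.
    move=> mF; apply: EFin_inj.
    have := fg F mF; rewrite (eq_meas_reduction fa mF) (eq_meas_reduction gb mF).
    by rewrite pE // qE.
  by rewrite /skewpart !pq //; exact: measurable_tr.
have half (a1 b1 c1 e1 : set (T * T) -> R) : signed_measure a1 -> signed_measure b1 ->
   signed_measure c1 -> (forall E, measurable E -> c1 E <= a1 E) ->
   (forall E, measurable E -> c1 (tr E) = c1 E) ->
   (forall E, measurable E -> skewpart a1 E = skewpart b1 E) ->
   (forall h, signed_measure h -> (forall E, measurable E -> h E <= b1 E) ->
      (forall E, measurable E -> h E <= b1 (tr E)) ->
      forall E, measurable E -> h E <= e1 E) ->
   forall E, measurable E -> c1 E - a1 E <= e1 E - b1 E.
  move=> sa1 sb1 sc1 ca1 c1t ab1 h1 E mE.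
  have := h1 (fun E => c1 E + (b1 E - a1 E)).
  have sh : signed_measure (fun E => c1 E + (b1 E - a1 E)).
    by apply: signed_measureD => //; exact: signed_measureB.
  move=> /(_ sh) h2; have {h2} : c1 E + (b1 E - a1 E) <= e1 E.
    apply: h2 => // F mF; first by have := ca1 F mF; lra.
    have := ca1 _ (measurable_tr mF); rewrite c1t //.
    by have := ab1 F mF; rewrite /skewpart; lra.
  lra.
move=> E mE; rewrite (eq_meas_reduction fa mE) (eq_meas_reduction gb mE).
rewrite /reduction /= cE // eE //= -!EFinB; congr EFin.
have h1 := half a b c e sa sb sc ca ct ab emax E mE.
have ba F : measurable F -> skewpart b F = skewpart a F by move=> mF; rewrite ab.
have h2 := half b a e c sb sa se eb et ba cmax E mE.
lra.
Qed.

End skew_part.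

(** * Extreme classes of flows *)

Section flows.
Context (R : realType) (d : measure_display) (J : measurableType d).
Context (beta : finite_measure2 J R) (phi : set J -> R).
Implicit Types (mu nu : finite_measure2 J R) (eta : set (J * J) -> R).

Let real_of mu : set (J * J) -> R := fine \o mu.

Let signed_real mu : signed_measure (real_of mu).
Proof. exact: signed_measure_finite_measure. Qed.

Let EFin_real mu : eq_meas mu (EFin \o real_of mu).
Proof. by move=> E mE; rewrite /= fineK // fin_num_measure. Qed.

Let real_ge0 mu E : 0 <= real_of mu E.
Proof. exact: fine_ge0. Qed.

Lemma boundary_skew mu X : measurable X ->
  boundary mu X = (skewpart (real_of mu) (X `*` ~` X))%:E.
Proof.
move=> mX; rewrite /boundary /skewpart tr_setX EFinB.
have mX' := measurable_cut mX; have := measurable_tr mX'; rewrite tr_setX => mX''.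
by rewrite (EFin_real _ mX') (EFin_real _ mX'').
Qed.

Lemma flowP mu : flow phi beta mu <->
  (forall E, measurable E -> real_of mu E <= real_of beta E) /\
  (forall X, measurable X -> skewpart (real_of mu) (X `*` ~` X) <= phi X).
Proof.
split=> -[h1 h2]; split.
- by move=> E mE; have := h1 E mE; rewrite !EFin_real.
- by move=> X mX; have := h2 X mX; rewrite boundary_skew.
- by move=> E mE; rewrite !EFin_real // lee_fin h1.
- by move=> X mX; rewrite boundary_skew // lee_fin h2.
Qed.

Lemma flow_skew_le mu : flow phi beta mu -> forall E, measurable E ->
  skewpart (real_of mu) E <= real_of beta E.
Proof.
move=> /flowP[h _] E mE; have := h E mE; have := real_ge0 mu (tr E).
by rewrite /skewpart; lra.
Qed.

(** The positive part of [a] is a flow, as it is the least nonnegative measure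
    above [a]. *)
Lemma flow_of_antisymmetric (a : set (J * J) -> R) : antisymmetric_measure a ->
  (forall E, measurable E -> a E <= real_of beta E) ->
  (forall X, measurable X -> a (X `*` ~` X) <= phi X) ->
  exists nu, flow phi beta nu /\
    forall E, measurable E -> skewpart (real_of nu) E = a E.
Proof.
move=> aa ab aphi; have [f [sf f0 fa _ fmin]] := antisymmetric_jordan aa.
have [nu nuE] := finite_measure_of_signed_measure sf f0.
have nuf E : measurable E -> real_of nu E = f E by move=> mE; rewrite /real_of /= nuE.
have nua E : measurable E -> skewpart (real_of nu) E = a E.
  by move=> mE; rewrite -fa // /skewpart !nuf //; exact: measurable_tr.
exists nu; split=> //; apply/flowP; split=> [E mE|X mX].
  by rewrite nuf //; exact: fmin.
by rewrite nua ?aphi //; exact: measurable_cut.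
Qed.

Lemma red_equiv_skew mu nu : red_equiv mu nu <->
  forall E, measurable E -> skewpart (real_of mu) E = skewpart (real_of nu) E.
Proof. exact: red_equivP. Qed.

Lemma red_equiv_mid mu1 mu2 nu :
  red_equiv (fun E => 2^-1%:E * mu1 E + (1 - 2^-1)%:E * mu2 E)%E nu <->
  forall E, measurable E ->
    (skewpart (real_of mu1) E + skewpart (real_of mu2) E) / 2 = skewpart (real_of nu) E.
Proof.
pose a E := 2^-1 * real_of mu1 E + (1 - 2^-1) * real_of mu2 E.
have sa : signed_measure a by apply: signed_measureD; exact: signed_measureZ.
have aE : eq_meas (fun E => 2^-1%:E * mu1 E + (1 - 2^-1)%:E * mu2 E)%E (EFin \o a).
  by move=> E mE; rewrite !EFin_real.
have aS E : skewpart a E = (skewpart (real_of mu1) E + skewpart (real_of mu2) E) / 2.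
  by rewrite /skewpart /a; lra.
apply: iff_trans (red_equivP sa (signed_real nu) aE (EFin_real nu)) _.
by split=> h E mE; rewrite -?h -?aS ?h.
Qed.

(** [eta] is a direction along which the skew part of [mu] can be moved both
    ways inside the convex set of skew parts of flows. *)
Definition perturbation mu eta := [/\ antisymmetric_measure eta,
  forall E, measurable E -> skewpart (real_of mu) E + eta E <= real_of beta E,
  forall E, measurable E -> skewpart (real_of mu) E - eta E <= real_of beta E &
  forall X, measurable X ->
    `|eta (X `*` ~` X)| <= phi X - skewpart (real_of mu) (X `*` ~` X)].

Lemma extreme_classP mu : flow phi beta mu ->
  extreme_class phi beta (flow_class phi beta mu) <->
  forall eta, perturbation mu eta -> forall E, measurable E -> eta E = 0.
Proof.
move=> fmu; split.
  move=> [_ ext] eta [[seta etaN] etap etam etaphi] E mE; apply: contrapT => etaE.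
  apply: ext.
  have [sS SN] := antisymmetric_skew (signed_real mu).
  have [|||nu1 [fnu1 nu1E]] :=
    @flow_of_antisymmetric (fun E => skewpart (real_of mu) E + eta E).
  - split; first exact: signed_measureD.
    by move=> F mF; rewrite SN // etaN //; lra.
  - exact: etap.
  - by move=> X mX; have := etaphi X mX; rewrite ler_norml => /andP[_]; lra.
  have [|||nu2 [fnu2 nu2E]] :=
    @flow_of_antisymmetric (fun E => skewpart (real_of mu) E - eta E).
  - split; first exact: signed_measureB.
    by move=> F mF; rewrite SN // etaN //; lra.
  - exact: etam.
  - by move=> X mX; have := etaphi X mX; rewrite ler_norml => /andP[+ _]; lra.
  exists (flow_class phi beta nu1), (flow_class phi beta nu2); split.
  - by exists nu1.
  - by exists nu2.
  - move=> C12; have : flow_class phi beta nu1 nu1 by split=> //; exact/red_equiv_skew.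
    rewrite C12 => -[_ /red_equiv_skew /(_ E mE)]; rewrite nu1E // nu2E //; lra.
  - apply/seteqP; split=> nu [fnu].
      move=> /red_equiv_skew munu; split=> //; exists nu1, nu2; split.
      + by split=> //; exact/red_equiv_skew.
      + by split=> //; exact/red_equiv_skew.
      + by apply/red_equiv_mid => F mF; rewrite nu1E // nu2E // -munu //; lra.
    move=> [m1 [m2 [[_ /red_equiv_skew m1E] [_ /red_equiv_skew m2E]]]].
    move=> /red_equiv_mid mid; split=> //; apply/red_equiv_skew => F mF.
    by rewrite -mid // -m1E // -m2E // nu1E // nu2E //; lra.
move=> noeta; split; first by exists mu.
move=> [C1 [C2 [[nu1 fnu1 C1E] [nu2 fnu2 C2E] C12 Cmid]]].
have : flow_class phi beta mu mu by split=> //; exact/red_equiv_skew.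
rewrite Cmid => -[_ [m1 [m2 []]]]; rewrite -C1E -C2E.
move=> [fm1 /red_equiv_skew nm1] [fm2 /red_equiv_skew nm2] /red_equiv_mid mid.
pose eta E := 2^-1 * (skewpart (real_of m1) E - skewpart (real_of m2) E).
have m12 E : measurable E -> skewpart (real_of m1) E = skewpart (real_of m2) E.
  have peta : perturbation mu eta.
    have [s1 n1] := antisymmetric_skew (signed_real m1).
    have [s2 n2] := antisymmetric_skew (signed_real m2).
    split.
    - split; first by apply: signed_measureZ; exact: signed_measureB.
      by move=> F mF; rewrite /eta n1 // n2 //; lra.
    - move=> F mF; have := flow_skew_le fm1 mF; have := mid F mF; rewrite /eta; lra.
    - move=> F mF; have := flow_skew_le fm2 mF; have := mid F mF; rewrite /eta; lra.
    - move=> X mX; have := (flowP m1).1 fm1 => -[_ /(_ X mX)].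
      have := (flowP m2).1 fm2 => -[_ /(_ X mX)].
      have := mid _ (measurable_cut mX).
      by rewrite /eta ler_norml => *; apply/andP; split; lra.
  by move=> mE; have := noeta _ peta E mE; rewrite /eta; lra.
apply: C12; rewrite -C1E -C2E; apply/seteqP; split=> nu [fnu /red_equiv_skew h].
  by split=> //; apply/red_equiv_skew => E mE; rewrite nm2 // -m12 // -nm1 // h.
by split=> //; apply/red_equiv_skew => E mE; rewrite nm1 // m12 // -nm2 // h.
Qed.

(** An antisymmetric [eta] satisfies [- eta <= beta - a] iff its transpose
    satisfies [eta <= beta^* + a]; this is why the residual is a meet. *)
Lemma residualP mu : flow phi beta mu -> exists r, [/\ signed_measure r,
  eq_meas (residual beta mu) (EFin \o r), forall E, measurable E -> 0 <= r E &
  forall eta, antisymmetric_measure eta ->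
    (forall E, measurable E -> eta E <= r E) <->
    (forall E, measurable E -> skewpart (real_of mu) E + eta E <= real_of beta E) /\
    (forall E, measurable E -> skewpart (real_of mu) E - eta E <= real_of beta E)].
Proof.
move=> fmu; set a := skewpart (real_of mu).
have [sa aN] : antisymmetric_measure a by exact: antisymmetric_skew.
have [p [sp pE pa]] := reductionP (signed_real mu).
have redE : eq_meas (reduction mu) (EFin \o p).
  by move=> E mE; rewrite -pE // (eq_meas_reduction (EFin_real mu)).
have sb := signed_real beta.
pose b1 E := real_of beta E - a E; pose b2 E := real_of beta (tr E) + a E.
have sb1 : signed_measure b1 by exact: signed_measureB.
have sb2 : signed_measure b2.
  by apply: signed_measureD => //; exact: signed_measure_tr.
have [r [sr rE rb1 rb2 rmax]] := meetP sb1 sb2.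
have resE : residual beta mu = meet (EFin \o b1) (EFin \o b2).
  apply: eq_meet => E mE; have mtE := measurable_tr mE.
    rewrite /= (EFin_real beta) // redE // /transpose -/(tr E) redE //=.
    by rewrite -EFinB -EFinD /b1 /a -pa // /skewpart; congr EFin; lra.
  rewrite /= redE // /transpose -/(tr E) redE // (EFin_real beta) //=.
  by rewrite -EFinB -EFinD /b2 /a -pa // /skewpart; congr EFin; lra.
exists r; split=> //; first by rewrite resE.
  apply: (rmax (cst 0)) => [|E mE|E mE]; first exact: signed_measure_cst0.
    by rewrite subr_ge0; exact: flow_skew_le.
  have := flow_skew_le fmu (measurable_tr mE); rewrite -/a aN // /b2 /=; lra.
move=> eta [seta etaN]; split=> [er|[h1 h2]].
  split=> E mE; first by have := er E mE; have := rb1 E mE; rewrite /b1; lra.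
  have mtE := measurable_tr mE; have := er _ mtE; have := rb2 _ mtE.
  by rewrite /b2 trK etaN // aN //; lra.
apply: (rmax eta) => // E mE; first by have := h1 E mE; rewrite /b1 -/a; lra.
by have := h2 _ (measurable_tr mE); rewrite -/a etaN // aN // /b2; lra.
Qed.

End flows.

Local Open Scope ereal_scope.

Theorem theorem4p7 (R : realType) (d : measure_display) (J : measurableType d)
    (beta : finite_measure2 J R) (phi : set J -> R)
    (mu : finite_measure2 J R) :
  standard_borel R J ->
  bounded_set_function phi -> continuous_set_function phi -> submodular phi ->
  phi set0 = 0%R -> phi setT = 0%R ->
  flow phi beta mu ->
  let psi : set J -> \bar R := (EFin \o phi) \- boundary mu in
  let Res := residual beta mu in
  extreme_class phi beta (flow_class phi beta mu) <->
  (bmm (kappa (cst 0) Res) `&` bmm psi `&` bmm (compl_fun psi) =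
     [set delta : additive_charge J R | eq_meas delta (cst 0)])
  /\
  ~ (exists rho : finite_measure2 J R,
       [/\ reduced rho, circulation rho, ~ eq_meas rho (cst 0)
         & le_meas rho Res]).
Proof.
move=> _ _ _ _ phi0 phiT fmu psi Res.
have ae := extreme_classP fmu.
have [r [sr rE r0 rP]] := residualP fmu.
pose a := skewpart (fine \o mu).
have aa : antisymmetric_measure a.
  by apply: antisymmetric_skew; exact: signed_measure_finite_measure.
have psiE X : measurable X -> psi X = (phi X - a (X `*` ~` X))%:E.
  by move=> mX; rewrite /psi /= boundary_skew.
have psi_ge0 X : measurable X -> (0 <= phi X - a (X `*` ~` X))%R.
  by move=> mX; rewrite subr_ge0; have [_ h] := (flowP _ _ _).1 fmu; exact: h.
have kE X : measurable X -> kappa (cst 0) Res X = (r (X `*` ~` X))%:E.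
  by move=> mX; rewrite /kappa /Res rE ?sube0 //; exact: measurable_cut.
have aT : a (setT `*` ~` setT) = 0%R by rewrite setCT setX0 aa.1.1.
have a0 : a (set0 `*` ~` set0) = 0%R by rewrite set0X aa.1.1.
have psiT : psi setT = 0 by rewrite psiE // aT phiT subrr.
have psicT : compl_fun psi setT = 0.
  by rewrite /compl_fun setCT psiE // a0 phi0 subrr.
split.
- move=> /ae ext; split.
  + apply/seteqP; split=> delta.
      move=> [[[dk dkT] [dpsi _]] [dpsic _]] X mX.
      have dE Y : measurable Y -> delta Y = (fine (delta Y))%:E.
        by move=> mY; rewrite fineK // fin_num_measure.
      (* [delta] is realised as the boundary of a measure below the residual. *)
      have [rho rhoE] := finite_measure_of_signed_measure sr r0.
      have [|||nu [snu nu0 nule nud]] := @Hoffman _ _ _ rho (fine \o delta).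
      * by move=> Y Z mY mZ YZ; exact: additive_chargeU.
      * move=> Y mY; rewrite rhoE; last exact: measurable_cut.
        by rewrite -lee_fin -dE // -kE //; exact: dk.
      * by rewrite /= dkT kE // setCT setX0 sr.1.
      have anu := antisymmetric_skew snu.
      have nuX Y : measurable Y -> skewpart nu (Y `*` ~` Y) = fine (delta Y).
        by move=> mY; rewrite (antisymmetric_cut anu) // /skewpart tr_setX nud.
      have nur E : measurable E -> (skewpart nu E <= r E)%R.
        move=> mE; have := nule E mE; rewrite rhoE //=.
        by have := nu0 _ (measurable_tr mE); rewrite /skewpart; lra.
      have [h1 h2] := (rP _ anu).1 nur.
      have nueta : perturbation beta phi mu (skewpart nu).
        split=> // Y mY; rewrite nuX // ler_norml; apply/andP; split.
          have mY' := measurableC mY; have := dpsic _ mY'.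
          rewrite /compl_fun setCK psiE // dE // lee_fin lerNl.
          apply: le_trans; rewrite lerNl.
          have := additive_chargeU delta mY mY' (setICr Y).
          by rewrite setUv dkT kE // setCT setX0 sr.1 /=; lra.
        by rewrite -lee_fin -dE // -psiE //; exact: dpsi.
      rewrite dE // -nuX // (ext _ nueta) //; exact: measurable_cut.
    move=> d0; have dT := d0 _ measurableT.
    split; [split|]; split=> [X mX|].
    * by rewrite d0 // kE // lee_fin r0 //; exact: measurable_cut.
    * by rewrite dT kE // setCT setX0 sr.1.
    * by rewrite d0 // psiE // lee_fin psi_ge0.
    * by rewrite dT psiT.
    * rewrite d0 // /compl_fun psiE; last exact: measurableC.
      by rewrite lee_fin psi_ge0 //; exact: measurableC.
    * by rewrite dT psicT.
  + move=> [rho [rho_red rho_circ rho0 rhor]].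
    have srho := signed_measure_finite_measure rho.
    have arho := antisymmetric_skew srho.
    have rhoE : eq_meas rho (EFin \o (fine \o rho)).
      by move=> E mE; rewrite /= fineK // fin_num_measure.
    have nur E : measurable E -> (skewpart (fine \o rho) E <= r E)%R.
      move=> mE; have : (fine (rho E) <= r E)%R.
        by have := rhor E mE; rewrite /Res rE // rhoE.
      have : (0 <= fine (rho (tr E)))%R by exact: fine_ge0.
      by rewrite /skewpart /=; lra.
    have [h1 h2] := (rP _ arho).1 nur.
    have pert : perturbation beta phi mu (skewpart (fine \o rho)).
      split=> // Y mY; rewrite (antisymmetric_cut arho) //.
      rewrite /skewpart /= tr_setX rho_circ // subrr normr0; exact: psi_ge0.
    (* A symmetric measure is its own meet with its transpose, so being reduced
       makes it vanish. *)
    have sym E : measurable E -> fine (rho E) = fine (rho (tr E)).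
      by move=> mE; have := ext _ pert E mE; rewrite /skewpart /=; lra.
    apply: rho0 => E mE; rewrite -(rho_red E mE).
    rewrite (eq_meet rhoE (eq_meas_transpose rhoE)).
    have [c [sc cE _ crho cmax]] := meet_transpose srho.
    rewrite cE // rhoE //=; congr EFin; apply/eqP; rewrite eq_le crho // andbT.
    by apply: (cmax (fine \o rho)) => // F mF; rewrite /= sym.
- move=> [bmm0 norho]; apply/ae => eta [eeta h1 h2 h3] E mE.
  apply: contrapT => etaE; apply: norho.
  have etar := (rP _ eeta).2 (conj h1 h2).
  have seta := eeta.1.
  have [c cE] := charge_of_signed_measure
    (signed_measure_pushforward (@measurable_fst _ _ J J) seta).
  pose delta : additive_charge J R := c.
  have cX X : measurable X -> delta X = (eta (X `*` ~` X))%:E.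
    move=> mX; rewrite [LHS]cE (antisymmetric_cut eeta) //; congr (eta _)%:E.
    by apply/seteqP; split=> -[x y] //= [].
  have c0 : eq_meas delta (cst 0).
    suff : [set delta : additive_charge J R | eq_meas delta (cst 0)] delta by [].
    rewrite -bmm0; split; [split|]; split=> [X mX|].
      * by rewrite cX // kE // lee_fin etar //; exact: measurable_cut.
      * by rewrite cX // kE // setCT setX0 sr.1 seta.1.
      * rewrite cX // psiE // lee_fin; have := h3 X mX.
        by rewrite ler_norml => /andP[].
      * by rewrite psiT cX // setCT setX0 seta.1.
      * have mX' := measurableC mX; rewrite /compl_fun psiE // cX // lee_fin.
        have := h3 _ mX'; rewrite ler_norml => /andP[+ _]; rewrite lerNl; apply: le_trans.
        rewrite setCK -(tr_setX X) eeta.2 ?opprK //; exact: measurable_cut.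
      * by rewrite psicT cX // setCT setX0 seta.1.
  have [f [sf f0 fa fred fmin]] := antisymmetric_jordan eeta.
  have [rho rhoE] := finite_measure_of_signed_measure sf f0.
  exists rho; split.
  + by rewrite /reduced (eq_meet rhoE (eq_meas_transpose rhoE)).
  + move=> X mX; have mXT := measurable_rect mX (@measurableT _ J).
    have mTX := measurable_rect (@measurableT _ J) mX.
    rewrite !rhoE //; congr EFin.
    have := c0 X mX; rewrite cX // (antisymmetric_cut eeta) // -fa // /skewpart tr_setX.
    by move=> [] /eqP; rewrite subr_eq0 => /eqP.
  + move=> rho0; apply: etaE; rewrite -fa // /skewpart.
    have f00 F : measurable F -> f F = 0%R.
      by move=> mF; apply: EFin_inj; rewrite -rhoE // rho0.
    by rewrite !f00 ?subrr //; exact: measurable_tr.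
  + by move=> F mF; rewrite rhoE // /Res rE // lee_fin; exact: fmin.
Qed.
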